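(* Let $\Gamma$ be an arbitrary group with identity $e$, let $A=\bigoplus_{g\in\Gamma}A_g$ be a faithfully $\Gamma$-graded quasi-Hopf algebra over a field $\Bbbk$, and let $L\subseteq A$ be an augmented quasi-Hopf ideal with $L\cap A_e=0$. Then $A=A_e+L$.
   Context: Conventions. $\Bbbk$ is a field; vector spaces, algebras and tensor products are over $\Bbbk$; algebras are unital and algebra (anti-)morphisms preserve units. Summation is suppressed: $\Delta(x)=x'\otimes x''$, $\Phi=\Phi^{(1)}\otimes\Phi^{(2)}\otimes\Phi^{(3)}$, $\Phi^{-1}=\Phi^{(-1)}\otimes\Phi^{(-2)}\otimes\Phi^{(-3)}$. Quasi-Hopf algebras. A quasi-Hopf algebra is an algebra $A$ with algebra morphisms $\Delta\colon A\to A\otimes A$, $\varepsilon\colon A\to\Bbbk$, an invertible $\Phi\in A^{\otimes 3}$, an algebra anti-morphism $S\colon A\to A$ (not assumed bijective) and elements $\alpha,\beta\in A$ such that for all $x\in A$: $(1\otimes\Phi)(\mathrm{id}\otimes\Delta\otimes\mathrm{id})(\Phi)(\Phi\otimes1)=(\mathrm{id}\otimes\mathrm{id}\otimes\Delta)(\Phi)(\Delta\otimes\mathrm{id}\otimes\mathrm{id})(\Phi)$; $\Phi(\Delta\otimes\mathrm{id})(\Delta(x))=(\mathrm{id}\otimes\Delta)(\Delta(x))\Phi$; $(\mathrm{id}\otimes\varepsilon\otimes\mathrm{id})(\Phi)=1\otimes1$; $(\mathrm{id}\otimes\varepsilon)\Delta(x)=x=(\varepsilon\otimes\mathrm{id})\Delta(x)$;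 $S(x')\alpha x''=\varepsilon(x)\alpha$; $x'\beta S(x'')=\varepsilon(x)\beta$; $\Phi^{(1)}\beta S(\Phi^{(2)})\alpha\Phi^{(3)}=1=S(\Phi^{(-1)})\alpha\Phi^{(-2)}\beta S(\Phi^{(-3)})$. Throughout, $(\alpha,\beta)$ is normalized by $\varepsilon(\alpha)=\varepsilon(\beta)=1$. A quasi-Hopf ideal of $A$ is a two-sided ideal $L$ with $\Delta(L)\subseteq L\otimes A+A\otimes L$, $\varepsilon(L)=0$, $S(L)\subseteq L$. Gradings. A $\Gamma$-graded quasi-Hopf algebra is a quasi-Hopf algebra with a vector space decomposition $A=\bigoplus_{g\in\Gamma}A_g$ such that $A_gA_h\subseteq A_{gh}$, $\Delta(A_g)\subseteq A_g\otimes A_g$, $S(A_g)\subseteq A_{g^{-1}}$, $\Phi\in A_e^{\otimes3}$, $\alpha,\beta\in A_e$. It is faithfully graded if $A_g\neq0$ for all $g\in\Gamma$. The group algebra $\Bbbk[\Gamma]$ has basis $\{\zeta_g\}_{g\in\Gamma}$ with $\zeta_g\zeta_h=\zeta_{gh}$; its augmentation ideal $\mathfrak{a}_\Gamma$ is the span of the elements $\zeta_g-\zeta_e$. The grading map of a faithfully graded $A$ is the linear map $\pi\colon A\to\Bbbk[\Gamma]$ with $\pi(x_g)=\varepsilon(x_g)\zeta_g$ for $x_g\in A_g$. A quasi-Hopf ideal $L\subseteq A$ is called augmented if $\pi(L)=\mathfrak{a}_\Gamma$. *)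

(* Defs.v *)
From HB Require Import structures.
From mathcomp Require Import all_boot all_algebra finmap.
From mathcomp Require Import boolp classical_sets.
From mathcomp Require Import monalg.

Set Implicit Arguments.
Unset Strict Implicit.
Unset Printing Implicit Defensive.

Import GRing.Theory Quotient.

Local Open Scope classical_set_scope.
Local Open Scope ring_scope.

Reserved Notation "x ⊗ y" (at level 38, left associativity).

Section Subspaces.
Variables (k : fieldType) (V : lmodType k).
Implicit Types X Y : set V.

Definition is_subspace X : Prop :=
  X 0 /\ forall (c : k) u v, X u -> X v -> X (c *: u + v).

Definition lspan X : set V :=
  [set v | exists2 s : seq (k * V),
     forall p, p \in s -> X p.2 & v = \sum_(p <- s) p.1 *: p.2].

Definition set_add X Y : set V := [set x + y | x in X & y in Y].

Lemma lspan_subspace X : is_subspace (lspan X).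
Proof.
split; first by exists [::] => //; rewrite big_nil.
move=> c u v [s sX ->] [t tX ->].
exists ([seq (c * p.1, p.2) | p <- s] ++ t).
  move=> p; rewrite mem_cat => /orP[/mapP[q qs ->]|]; last exact: tX.
  exact: sX qs.
rewrite big_cat big_map /= scaler_sumr; congr (_ + _).
by apply: eq_bigr => p _; rewrite scalerA.
Qed.

Lemma lspan_incl X v : X v -> lspan X v.
Proof.
move=> Xv; exists [:: (1, v)]; last by rewrite big_seq1 scale1r.
by move=> p; rewrite inE => /eqP ->.
Qed.

End Subspaces.

Lemma sum_of_linear (k : fieldType) (V W : lmodType k) (f : V -> W) :
  linear f -> forall (I : Type) (s : seq I) (F : I -> V),
  f (\sum_(i <- s) F i) = \sum_(i <- s) f (F i).
Proof.
move=> fL I s F; pose g : {linear V -> W} :=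
  HB.pack f (GRing.isLinear.Build k V W _ f fL).
exact: (raddf_sum g).
Qed.

Section DualVector.
Variables (k : fieldType) (V : lmodType k) (v : V) (v0 : v != 0).

Let avoids (X : set V) :=
  (forall (c : k) x y, X x -> X y -> X (c *: x + y)) /\ ~ X v.

Let dual_hyperplane : exists H : set V,
  is_subspace H /\ forall x, exists! a : k, H (x - a *: v).
Proof.
have [F FP Ftot|H [[HL Hv] Hmax]] := @Zorn_bigcup V avoids.
  split=> [c x y [X FX Xx] [Y FY Yy]|[X FX Xv]]; last exact: (FP X FX).2.
  have [XY|YX] := Ftot X Y FX FY.
  - by exists Y => //; apply: (FP Y FY).1 => //; apply: XY.
  - by exists X => //; apply: (FP X FX).1 => //; apply: YX.
have H0 : H 0.
  apply: contrapT => nH0.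
  have He x : ~ H x by move=> Hx; apply: nH0; have := HL (-1) x x Hx Hx;
    rewrite scaleN1r addNr.
  apply: (Hmax [set 0]).
    by split=> [x /He //|/(_ 0 erefl) /nH0].
  split=> [c x y -> ->|/eqP]; first by rewrite scaler0 addr0.
  exact/negP.
have HZ c x : H x -> H (c *: x) by move=> Hx; rewrite -[_ *: _]addr0; apply: HL.
exists H; split=> // x.
have [a Ha] : exists a : k, H (x - a *: v).
  have [Hx|nHx] := pselect (H x); first by exists 0; rewrite scale0r subr0.
  pose B := [set y | exists c : k, H (y - c *: x)].
  have [c Hc] : B v.
    apply: contrapT => nBv; apply: (Hmax B); last first.
      split=> // c y z [a Ha] [b Hb]; exists (c * a + b) => //.
      have -> : c *: y + z - (c * a + b) *: x = c *: (y - a *: x) + (z - b *: x).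
        by rewrite scalerBr scalerDl scalerA opprD addrACA.
      exact: HL.
    split=> [y Hy|BH]; first by exists 0; rewrite ?scale0r ?subr0.
    by apply/nHx/BH; exists 1; rewrite ?scale1r ?subrr.
  have c0 : c != 0.
    by apply/eqP => c0; apply: Hv; move: Hc; rewrite c0 scale0r subr0.
  exists c^-1; move/(HZ (- c^-1)) : Hc.
  by rewrite scalerBr scaleNr scaleNr scalerA mulVf // scale1r opprK addrC.
exists a; split=> // b Hb; have [//|ab] := eqVneq a b; case: Hv.
have ab0 : a - b != 0 by rewrite subr_eq0.
have /(HZ (a - b)^-1) : H ((a - b) *: v).
  have := HL (-1) _ _ Ha Hb; rewrite scaleN1r opprB scalerBl.
  by rewrite addrA subrK.
by rewrite scalerA mulVf // scale1r.
Qed.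

Lemma dual_vector : exists f : {linear V -> k^o}, f v = 1.
Proof.
have [H [[H0 HL] Hex]] := dual_hyperplane.
have [f fP] := choice Hex.
have fE x a : H (x - a *: v) -> f x = a by apply: (fP x).2.
have f_lin : linear (f : V -> k^o).
  move=> c x y; apply: fE.
  have := HL c _ _ (fP x).1 (fP y).1.
  by rewrite scalerBr scalerDl scalerA opprD addrACA.
pose g : {linear V -> k^o} := HB.pack f (GRing.isLinear.Build k V k^o _ f f_lin).
exists g => /=.
by apply: fE; rewrite scale1r subrr.
Qed.

End DualVector.

Section FreeModuleLift.
Variables (k : fieldType) (T : choiceType) (W : lmodType k) (f : T -> W).

Definition malg_lift (g : {malg k[T]}) : W := \sum_(x <- msupp g) g@_x *: f x.

Lemma malg_liftEw (d : {fset T}) (g : {malg k[T]}) :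
  {subset msupp g <= d} -> malg_lift g = \sum_(x <- d) g@_x *: f x.
Proof.
move=> sub; rewrite /malg_lift; apply: big_fset_incl; first exact/fsubsetP.
by move=> x _ xg; rewrite mcoeff_outdom // scale0r.
Qed.

Fact malg_lift_linear : linear malg_lift.
Proof.
move=> a g h; pose d := (msupp g `|` msupp h `|` msupp (a *: g + h))%fset.
rewrite !(@malg_liftEw d); try by move=> x; rewrite !inE => ->; rewrite ?orbT.
rewrite scaler_sumr -big_split; apply: eq_bigr => x _ /=.
by rewrite mcoeffD mcoeffZ scalerDl scalerA.
Qed.

HB.instance Definition _ :=
  GRing.isLinear.Build k {malg k[T]} W _ malg_lift malg_lift_linear.

Lemma malg_liftU x : malg_lift << x >> = f x.
Proof.
rewrite (@malg_liftEw [fset x]%fset) ?big_seq_fset1 ?mcoeffUU ?scale1r //.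
exact/fsubsetP/msuppU_le.
Qed.

End FreeModuleLift.

Section Tensor.
Variables (k : fieldType) (U V : lmodType k).

Local Notation F := {malg k[(U * V)%type]}.
Local Notation gen u v := (<< (u, v) >> : F).

Definition tensor_relator : set F := [set r |
  (exists a u u' v, r = gen (a *: u + u') v - (a *: gen u v + gen u' v)) \/
  (exists a u v v', r = gen u (a *: v + v') - (a *: gen u v + gen u v'))].

Definition tensor_ker : pred F := fun r => `[< lspan tensor_relator r >].

Lemma tensor_kerZD (a : k) : {in tensor_ker &, forall x y, a *: x + y \in tensor_ker}.
Proof.
by move=> x y /asboolP xK /asboolP yK; apply/asboolP; apply: (lspan_subspace _).2.
Qed.

Lemma tensor_ker0 : 0 \in tensor_ker.
Proof. by apply/asboolP; apply: (lspan_subspace _).1. Qed.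

Fact tensor_ker_zmod_closed : zmod_closed tensor_ker.
Proof.
split; first exact: tensor_ker0.
by move=> x y xK yK; rewrite addrC -scaleN1r tensor_kerZD.
Qed.

HB.instance Definition _ :=
  GRing.isZmodClosed.Build F tensor_ker tensor_ker_zmod_closed.

(* The free module on U * V modulo the bilinearity relations. *)
Definition tensor : Type := {quot (GRing.ZmodClosed.clone F tensor_ker _)}.
HB.instance Definition _ := GRing.Zmodule.on tensor.

Definition tensor_pi : F -> tensor :=
  \pi_({quot (GRing.ZmodClosed.clone F tensor_ker _)})%qT.

Fact tensor_pi_zmod_morphism : zmod_morphism tensor_pi.
Proof. exact: pi_is_zmod_morphism. Qed.
HB.instance Definition _ :=
  GRing.isZmodMorphism.Build F tensor tensor_pi tensor_pi_zmod_morphism.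

Definition tensor_repr (t : tensor) : F := repr t.

Lemma tensor_reprK : cancel tensor_repr tensor_pi.
Proof. exact: reprK. Qed.

Lemma tensor_pi_eq x y : tensor_pi x = tensor_pi y <-> x - y \in tensor_ker.
Proof. by rewrite idealrBE; split=> [e|/eqP //]; apply/eqP. Qed.

Definition tensor_scale (a : k) (t : tensor) : tensor :=
  tensor_pi (a *: tensor_repr t).

Lemma tensor_scale_pi a x : tensor_scale a (tensor_pi x) = tensor_pi (a *: x).
Proof.
apply/tensor_pi_eq; rewrite -scalerBr -[_ *: _]addr0 tensor_kerZD ?tensor_ker0 //.
by apply/tensor_pi_eq; rewrite tensor_reprK.
Qed.

Fact tensor_scaleA a b t :
  tensor_scale a (tensor_scale b t) = tensor_scale (a * b) t.
Proof.
by rewrite -[t]tensor_reprK !tensor_scale_pi scalerA.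
Qed.

Fact tensor_scale1 : left_id 1 tensor_scale.
Proof. by move=> t; rewrite -[t]tensor_reprK tensor_scale_pi scale1r. Qed.

Fact tensor_scaleDr : right_distributive tensor_scale +%R.
Proof.
move=> a s t; rewrite -[s]tensor_reprK -[t]tensor_reprK -raddfD.
by rewrite !tensor_scale_pi scalerDr raddfD.
Qed.

Fact tensor_scaleDl t : {morph tensor_scale^~ t : a b / a + b}.
Proof.
move=> a b; rewrite -[t]tensor_reprK.
by rewrite !tensor_scale_pi scalerDl raddfD.
Qed.

HB.instance Definition _ := GRing.Zmodule_isLmodule.Build k tensor
  tensor_scaleA tensor_scale1 tensor_scaleDr tensor_scaleDl.

Fact tensor_pi_scalable : scalable tensor_pi.
Proof. by move=> a x; rewrite -tensor_scale_pi. Qed.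
HB.instance Definition _ :=
  GRing.isScalable.Build k F tensor *:%R tensor_pi tensor_pi_scalable.

End Tensor.

HB.lock Definition tpure (k : fieldType) (U V : lmodType k) (u : U) (v : V) :
  tensor U V := tensor_pi << (u, v) >>.
Arguments tpure {k U V} u v.

Notation "U ⊗ V" := (tensor U%type V%type) : type_scope.
Notation "u ⊗ v" := (tpure u v) : ring_scope.

Section PureTensors.
Variables (k : fieldType) (U V : lmodType k).

Local Notation F := {malg k[(U * V)%type]}.
Local Notation gen u v := (<< (u, v) >> : F).

Lemma tpure_linearl (v : V) : linear (fun u : U => u ⊗ v).
Proof.
move=> a u u'; rewrite tpure.unlock -linearP; apply/tensor_pi_eq/asboolP/lspan_incl.
by left; exists a, u, u', v.
Qed.

Lemma tpure_linearr (u : U) : linear (fun v : V => u ⊗ v).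
Proof.
move=> a v v'; rewrite tpure.unlock -linearP; apply/tensor_pi_eq/asboolP/lspan_incl.
by right; exists a, u, v, v'.
Qed.

Lemma tensor_span (t : U ⊗ V) :
  exists s : seq (U * V), t = \sum_(p <- s) p.1 ⊗ p.2.
Proof.
pose g := tensor_repr t.
exists [seq (g@_p *: p.1, p.2) | p <- msupp g].
rewrite -[t]tensor_reprK -/g [in LHS](monalgE g) raddf_sum big_map.
apply: eq_bigr => -[u v] _ /=.
have -> : << g@_(u, v) *g (u, v) >> = g@_(u, v) *: gen u v :> F.
  by apply/malgP => p; rewrite mcoeffZ !mcoeffU mulrnAr mulr1.
rewrite linearZ (scalable_linear (tpure_linearl v)).
by rewrite tpure.unlock.
Qed.

End PureTensors.

Definition bilinear_map (k : fieldType) (U V W : lmodType k) (f : U -> V -> W) :=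
  (forall v, linear (f^~ v)) /\ (forall u, linear (f u)).

(* Only meaningful when f is bilinear; see tlift_pure and tlift_linear. *)
HB.lock Definition tlift (k : fieldType) (U V W : lmodType k) (f : U -> V -> W)
    (t : U ⊗ V) : W :=
  malg_lift (fun p => f p.1 p.2) (tensor_repr t).
Arguments tlift {k U V W} f t.

Section TensorLift.
Variables (k : fieldType) (U V W : lmodType k).
Variables (f : U -> V -> W) (fB : bilinear_map f).

Lemma tlift_pi x : tlift f (tensor_pi x) = malg_lift (fun p => f p.1 p.2) x.
Proof.
rewrite tlift.unlock; apply/eqP; rewrite -subr_eq0 -raddfB; apply/eqP.
have /tensor_pi_eq/asboolP[s sR ->] := tensor_reprK (tensor_pi x).
rewrite raddf_sum big1_seq // => p /andP[_ /sR relp] /=; rewrite linearZ_LR /=.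
case: relp => -[a [u [v [w ->]]]]; rewrite raddfB /= linearP /= !malg_liftU /=.
- by rewrite fB.1 subrr scaler0.
- by rewrite fB.2 subrr scaler0.
Qed.

Lemma tlift_pure u v : tlift f (u ⊗ v) = f u v.
Proof. by rewrite tpure.unlock tlift_pi malg_liftU. Qed.

Lemma tlift_linear : linear (tlift f).
Proof.
move=> a s t; rewrite -[s]tensor_reprK -[t]tensor_reprK -linearP !tlift_pi.
exact: linearP.
Qed.

Lemma tensor_ext (g h : {linear (U ⊗ V)%type -> W}) :
  (forall u v, g (u ⊗ v) = h (u ⊗ v)) -> g =1 h.
Proof.
move=> gh t; have [s ->] := tensor_span t.
by rewrite !raddf_sum; apply: eq_bigr => p _; apply: gh.
Qed.

End TensorLift.

Section TensorMaps.
Variable k : fieldType.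
Implicit Types U V W : lmodType k.

Definition tmap U V U' V' (f : U -> U') (g : V -> V') : U ⊗ V -> U' ⊗ V' :=
  tlift (fun u v => f u ⊗ g v).

Fact tmap_bilinear U V U' V' (f : {linear U -> U'}) (g : {linear V -> V'}) :
  bilinear_map (fun u v => f u ⊗ g v).
Proof.
split=> [v|u] a x y /=; first by rewrite linearP tpure_linearl.
by rewrite linearP tpure_linearr.
Qed.

Lemma tmap_pure U V U' V' (f : {linear U -> U'}) (g : {linear V -> V'}) u v :
  tmap f g (u ⊗ v) = f u ⊗ g v.
Proof. exact/tlift_pure/tmap_bilinear. Qed.

HB.instance Definition _ U V U' V' (f : {linear U -> U'}) (g : {linear V -> V'}) :=
  GRing.isLinear.Build k (U ⊗ V)%type (U' ⊗ V')%type _ (tmap f g)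
    (tlift_linear (tmap_bilinear f g)).

Definition tassoc U V W : U ⊗ (V ⊗ W) -> U ⊗ V ⊗ W :=
  tlift (fun u => tlift (fun v w => u ⊗ v ⊗ w)).

Fact tassoc_bilinear1 U V W (u : U) : bilinear_map (fun (v : V) (w : W) => u ⊗ v ⊗ w).
Proof.
split=> [w|v] a x y /=; first by rewrite tpure_linearr tpure_linearl.
by rewrite tpure_linearr.
Qed.

Lemma tlift_bilinear U V W (Z : lmodType k) (f : U -> V -> W -> Z) :
  (forall v w, linear (fun u => f u v w)) -> (forall u, bilinear_map (f u)) ->
  bilinear_map (fun u => tlift (f u)).
Proof.
move=> f1 f2; split=> [t|u]; last exact/tlift_linear/f2.
have [s ->] := tensor_span t.
pose L u := tlift_linear (f2 u).
have sumE u : tlift (f u) (\sum_(p <- s) p.1 ⊗ p.2) = \sum_(p <- s) f u p.1 p.2.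
  rewrite (sum_of_linear (L u)); apply: eq_bigr => p _.
  exact: tlift_pure.
move=> a u u'; rewrite !sumE scaler_sumr -big_split.
by apply: eq_bigr => p _; apply: f1.
Qed.

Fact tassoc_bilinear U V W :
  bilinear_map (fun u => tlift (fun (v : V) (w : W) => u ⊗ v ⊗ w) : _ -> U ⊗ V ⊗ W).
Proof.
apply: tlift_bilinear => [v w a x y|u]; first by rewrite !tpure_linearl.
exact: tassoc_bilinear1.
Qed.

Lemma tassoc_pure U V W (u : U) (v : V) (w : W) :
  tassoc (u ⊗ (v ⊗ w)) = u ⊗ v ⊗ w.
Proof.
by rewrite /tassoc (tlift_pure (tassoc_bilinear _ _ _))
           (tlift_pure (tassoc_bilinear1 _ _ _)).
Qed.

HB.instance Definition _ U V W :=
  GRing.isLinear.Build k (U ⊗ (V ⊗ W))%type (U ⊗ V ⊗ W)%type _ (@tassoc U V W)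
    (tlift_linear (tassoc_bilinear U V W)).

End TensorMaps.

HB.lock Definition tmul (k : fieldType) (A B : algType k) (s t : A ⊗ B) : A ⊗ B :=
  tlift (fun a b => tlift (fun a' b' => (a * a') ⊗ (b * b')) t) s.
Arguments tmul {k A B} s t.

Section TensorAlgebra.
Variables (k : fieldType) (A B : algType k).
Implicit Types s t : A ⊗ B.

Fact tmul_bilinear2 (a : A) (b : B) :
  bilinear_map (fun a' b' => (a * a') ⊗ (b * b')).
Proof.
split=> [b'|a'] c x y /=; rewrite mulrDr -scalerAr.
- by rewrite tpure_linearl.
- by rewrite tpure_linearr.
Qed.

Fact tmul_bilinear1 (t : A ⊗ B) :
  bilinear_map (fun (a : A) (b : B) => tlift (fun a' b' => (a * a') ⊗ (b * b')) t).
Proof.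
split=> [b|a].
  apply: (tlift_bilinear (f := fun a a' b' => (a * a') ⊗ (b * b')) _ _).1.
    by move=> a' b' c x y; rewrite mulrDl -scalerAl tpure_linearl.
  exact: (fun a => tmul_bilinear2 a b).
apply: (tlift_bilinear (f := fun b a' b' => (a * a') ⊗ (b * b')) _ _).1.
  by move=> a' b' c x y; rewrite mulrDl -scalerAl tpure_linearr.
exact: tmul_bilinear2.
Qed.

Fact tmul_linearl t : linear (tmul^~ t).
Proof. rewrite tmul.unlock; exact/tlift_linear/tmul_bilinear1. Qed.

Fact tmul_linearr s : linear (tmul s).
Proof.
have [r ->] := tensor_span s.
have E t : tmul (\sum_(p <- r) p.1 ⊗ p.2) t =
    \sum_(p <- r) tlift (fun a' b' => (p.1 * a') ⊗ (p.2 * b')) t.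
  rewrite (sum_of_linear (tmul_linearl t)); apply: eq_bigr => p _.
  by rewrite tmul.unlock (tlift_pure (tmul_bilinear1 t)).
move=> c x y; rewrite !E scaler_sumr -big_split; apply: eq_bigr => p _.
exact/tlift_linear/tmul_bilinear2.
Qed.

Lemma tmul_pure (a a' : A) (b b' : B) :
  tmul (a ⊗ b) (a' ⊗ b') = (a * a') ⊗ (b * b').
Proof.
by rewrite tmul.unlock (tlift_pure (tmul_bilinear1 _)) (tlift_pure (tmul_bilinear2 _ _)).
Qed.

Fact tmulDl : left_distributive (@tmul k A B) +%R.
Proof. by move=> s t r; have := tmul_linearl r 1 s t; rewrite !scale1r. Qed.

Fact tmulDr : right_distributive (@tmul k A B) +%R.
Proof. by move=> r s t; have := tmul_linearr r 1 s t; rewrite !scale1r. Qed.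

Fact tmul0l : left_zero 0 (@tmul k A B).
Proof.
by move=> t; apply: (addrI (tmul 0 t)); rewrite -tmulDl !addr0.
Qed.

Fact tmul0r : right_zero 0 (@tmul k A B).
Proof.
by move=> t; apply: (addrI (tmul t 0)); rewrite -tmulDr !addr0.
Qed.

Lemma tensor_ind (P : A ⊗ B -> Prop) :
  P 0 -> (forall s t, P s -> P t -> P (s + t)) -> (forall u v, P (u ⊗ v)) ->
  forall t, P t.
Proof.
move=> P0 PD Pp t; have [s ->] := tensor_span t.
by elim/big_ind: _ => // p _; apply: Pp.
Qed.

Fact tmulA : associative (@tmul k A B).
Proof.
move=> r s t; elim/tensor_ind: r => [|r r' IH IH'|a b].
- by rewrite !tmul0l.
- by rewrite !tmulDl IH IH'.
elim/tensor_ind: s => [|s s' IH IH'|a' b'].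
- by rewrite !(tmul0r, tmul0l).
- by rewrite !(tmulDl, tmulDr) IH IH'.
elim/tensor_ind: t => [|t t' IH IH'|a'' b''].
- by rewrite !tmul0r.
- by rewrite !tmulDr IH IH'.
by rewrite !tmul_pure !mulrA.
Qed.

Fact tmul1l : left_id (1 ⊗ 1) (@tmul k A B).
Proof.
move=> t; elim/tensor_ind: t => [|s t IHs IHt|a b]; first exact: tmul0r.
- by rewrite tmulDr IHs IHt.
- by rewrite tmul_pure !mul1r.
Qed.

Fact tmul1r : right_id (1 ⊗ 1) (@tmul k A B).
Proof.
move=> t; elim/tensor_ind: t => [|s t IHs IHt|a b]; first exact: tmul0l.
- by rewrite tmulDl IHs IHt.
- by rewrite tmul_pure !mulr1.
Qed.

Fact tensor1_neq0 : (1 : A) ⊗ (1 : B) != 0.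
Proof.
have [f f1] := dual_vector (oner_neq0 A); have [g g1] := dual_vector (oner_neq0 B).
have fgB : bilinear_map (fun a b => f a * g b : k^o).
  split=> [b|a] c x y /=; rewrite linearP /=.
  - by rewrite mulrDl -scalerAl.
  - by rewrite mulrDr -scalerAr.
apply/eqP => /(congr1 (tlift (fun a b => f a * g b : k^o))).
rewrite (tlift_pure fgB) f1 g1 mulr1 => E.
have := tlift_linear fgB (-1) 0 0; rewrite scaler0 addr0 scaleN1r addNr -E.
by apply/eqP/oner_neq0.
Qed.

HB.instance Definition _ := GRing.Zmodule_isNzRing.Build (A ⊗ B)%type
  tmulA tmul1l tmul1r tmulDl tmulDr tensor1_neq0.

Fact tensor_scalerAl (c : k) (s t : A ⊗ B) : c *: tmul s t = tmul (c *: s) t.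
Proof. by rewrite (scalable_linear (tmul_linearl t)). Qed.

Fact tensor_scalerAr (c : k) (s t : A ⊗ B) : c *: tmul s t = tmul s (c *: t).
Proof. by rewrite (scalable_linear (tmul_linearr s)). Qed.

HB.instance Definition _ :=
  GRing.Lmodule_isLalgebra.Build k (A ⊗ B)%type tensor_scalerAl.
HB.instance Definition _ :=
  GRing.Lalgebra_isAlgebra.Build k (A ⊗ B)%type tensor_scalerAr.

Lemma tensorM_pure (a a' : A) (b b' : B) :
  (a ⊗ b) * (a' ⊗ b') = (a * a') ⊗ (b * b').
Proof. exact: tmul_pure. Qed.

Lemma tensor1E : 1 = 1 ⊗ 1 :> A ⊗ B.
Proof. by []. Qed.

End TensorAlgebra.

Definition group_algebra (k : fieldType) (Gamma : groupType) : Type :=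
  {malg k[Gamma]}.

HB.instance Definition _ (k : fieldType) (Gamma : groupType) :=
  GRing.Lmodule.on (group_algebra k Gamma).

HB.lock Definition zeta (k : fieldType) (Gamma : groupType) (g : Gamma) :
  group_algebra k Gamma := << g >>.
Arguments zeta {k Gamma} g.

HB.lock Definition gmul (k : fieldType) (Gamma : groupType)
    (x y : group_algebra k Gamma) : group_algebra k Gamma :=
  malg_lift (fun g => malg_lift (fun h => zeta (g * h)%g) y) x.
Arguments gmul {k Gamma} x y.

Section GroupAlgebra.
Variables (k : fieldType) (Gamma : groupType).

Local Notation kG := (group_algebra k Gamma).
Implicit Types x y z : kG.

Lemma zeta_span x : x = \sum_(g <- msupp x) x@_g *: zeta g.
Proof.
rewrite [LHS]monalgE zeta.unlock; apply: eq_bigr => g _.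
by apply/malgP => h; rewrite mcoeffZ !mcoeffU mulrnAr mulr1.
Qed.

Fact gmul_linearl y : linear (gmul^~ y).
Proof. rewrite gmul.unlock; exact: malg_lift_linear. Qed.

Fact gmul_linearr x : linear (gmul x).
Proof.
move=> a y z; rewrite gmul.unlock /malg_lift scaler_sumr -big_split.
apply: eq_bigr => g _ /=.
have := malg_lift_linear (fun h => zeta (g * h)%g) a y z; rewrite /malg_lift => ->.
by rewrite scalerDr !scalerA mulrC.
Qed.

Lemma gmul_zeta (g h : Gamma) : gmul (zeta g) (zeta h) = zeta (g * h)%g :> kG.
Proof. by rewrite gmul.unlock zeta.unlock !malg_liftU. Qed.

Fact gmulDl : left_distributive (@gmul k Gamma) +%R.
Proof. by move=> x y z; have := gmul_linearl z 1 x y; rewrite !scale1r. Qed.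

Fact gmulDr : right_distributive (@gmul k Gamma) +%R.
Proof. by move=> z x y; have := gmul_linearr z 1 x y; rewrite !scale1r. Qed.

Fact gmul0l y : gmul 0 y = 0.
Proof. by apply: (addrI (gmul 0 y)); rewrite -gmulDl !addr0. Qed.

Fact gmul0r x : gmul x 0 = 0.
Proof. by apply: (addrI (gmul x 0)); rewrite -gmulDr !addr0. Qed.

Fact gmulZl c x y : gmul (c *: x) y = c *: gmul x y.
Proof. by have := gmul_linearl y c x 0; rewrite !addr0 gmul0l addr0. Qed.

Fact gmulZr c x y : gmul x (c *: y) = c *: gmul x y.
Proof. by have := gmul_linearr x c y 0; rewrite !addr0 gmul0r addr0. Qed.

Lemma group_algebra_ind (P : kG -> Prop) :
  P 0 -> (forall x y, P x -> P y -> P (x + y)) ->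
  (forall c g, P (c *: zeta g)) -> forall x, P x.
Proof.
move=> P0 PD Pz x; rewrite (zeta_span x).
by elim/big_ind: _ => // g _; apply: Pz.
Qed.

Fact gmulA : associative (@gmul k Gamma).
Proof.
move=> x y z; elim/group_algebra_ind: x => [|x x' IH IH'|c g].
- by rewrite !gmul0l.
- by rewrite !gmulDl IH IH'.
elim/group_algebra_ind: y => [|y y' IH IH'|d h].
- by rewrite gmul0l !gmul0r gmul0l.
- by rewrite gmulDl !gmulDr gmulDl IH IH'.
elim/group_algebra_ind: z => [|z z' IH IH'|e i].
- by rewrite !gmul0r.
- by rewrite !gmulDr IH IH'.
rewrite (gmulZl d) (gmulZl c (zeta g)) (gmulZl c) (gmulZr e (zeta h)).
rewrite (gmulZr d (zeta g)) (gmulZr e (zeta g)) (gmulZr d (zeta g)) !gmul_zeta.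
by rewrite (gmulZl c) (gmulZl d) (gmulZr e) gmul_zeta mulgA.
Qed.

Fact gmul1l : left_id (zeta 1%g) (@gmul k Gamma).
Proof.
move=> x; elim/group_algebra_ind: x => [|x y IHx IHy|c g]; first exact: gmul0r.
- by rewrite gmulDr IHx IHy.
- by rewrite gmulZr gmul_zeta mul1g.
Qed.

Fact gmul1r : right_id (zeta 1%g) (@gmul k Gamma).
Proof.
move=> x; elim/group_algebra_ind: x => [|x y IHx IHy|c g]; first exact: gmul0l.
- by rewrite gmulDl IHx IHy.
- by rewrite gmulZl gmul_zeta mulg1.
Qed.

Fact zeta1_neq0 : zeta 1%g != 0 :> kG.
Proof. by rewrite zeta.unlock monalgU_eq0 oner_neq0. Qed.

HB.instance Definition _ := GRing.Zmodule_isNzRing.Build kG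
  gmulA gmul1l gmul1r gmulDl gmulDr zeta1_neq0.

HB.instance Definition _ := GRing.Lmodule_isLalgebra.Build k kG
  (fun c x y => esym (gmulZl c x y)).
HB.instance Definition _ := GRing.Lalgebra_isAlgebra.Build k kG
  (fun c x y => esym (gmulZr c x y)).

Lemma zetaM (g h : Gamma) : zeta g * zeta h = zeta (g * h)%g :> kG.
Proof. exact: gmul_zeta. Qed.

Definition augmentation_ideal : set kG :=
  lspan [set zeta g - zeta 1%g | g in [set: Gamma]].

End GroupAlgebra.

Arguments augmentation_ideal : clear implicits.

(* coassoc is Phi and coassocV its inverse; A ⊗ A ⊗ A is (A ⊗ A) ⊗ A, and tassoc
   moves every other bracketing to the left. The maps given to tlift spell out
   Sweedler notation, e.g. S(x') alpha x'' is the image of coprod x under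
   a ⊗ b |-> S(a) alpha b. *)
Record quasiHopf (k : fieldType) (A : algType k) := QuasiHopf {
  coprod : {lrmorphism A -> (A ⊗ A)%type};
  counit : {lrmorphism A -> k^o};
  coassoc : (A ⊗ A ⊗ A)%type;
  coassocV : (A ⊗ A ⊗ A)%type;
  antipode : {linear A -> A};
  qalpha : A;
  qbeta : A;
  coassocK : coassocV * coassoc = 1;
  coassocVK : coassoc * coassocV = 1;
  antipode1 : antipode 1 = 1;
  antipodeM : forall x y, antipode (x * y) = antipode y * antipode x;
  coassoc_pentagon :
    tmap (tassoc (U := A) (V := A) (W := A)) idfun (tassoc (1 ⊗ coassoc))
      * tmap (tassoc (U := A) (V := A) (W := A)) idfun
          (tmap (tmap idfun coprod) idfun coassoc)
      * (coassoc ⊗ 1)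
    = tassoc (tmap idfun coprod coassoc) * tmap (tmap coprod idfun) idfun coassoc;
  coprod_coassoc : forall x : A,
    coassoc * tmap coprod idfun (coprod x)
    = tassoc (tmap idfun coprod (coprod x)) * coassoc;
  coassoc_counit :
    tmap (tlift (fun a b => counit b *: a)) idfun coassoc = 1 ⊗ 1 :> (A ⊗ A)%type;
  coprod_counitr : forall x : A, tlift (fun a b => counit b *: a) (coprod x) = x;
  coprod_counitl : forall x : A, tlift (fun a b => counit a *: b) (coprod x) = x;
  antipode_alpha : forall x : A,
    tlift (fun a b => antipode a * qalpha * b) (coprod x) = counit x *: qalpha;
  antipode_beta : forall x : A,
    tlift (fun a b => a * qbeta * antipode b) (coprod x) = counit x *: qbeta;
  coassoc_antipode :
    tlift (fun t c => tlift (fun a b => a * qbeta * antipode b) t * qalpha * c)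
      coassoc = 1;
  coassocV_antipode :
    tlift (fun t c =>
        tlift (fun a b => antipode a * qalpha * b) t * qbeta * antipode c)
      coassocV = 1;
  counit_alpha : counit qalpha = 1;
  counit_beta : counit qbeta = 1
}.

(* Over a field, X ⊗ Y for subspaces X and Y is identified with its image in U ⊗ V. *)
Definition tensor_sub (k : fieldType) (U V : lmodType k) (X : set U) (Y : set V) :
    set (U ⊗ V) :=
  lspan [set x ⊗ y | x in X & y in Y].

Record quasiHopf_ideal (k : fieldType) (A : algType k) (H : quasiHopf A)
    (L : set A) : Prop := {
  qh_ideal_subspace : is_subspace L;
  qh_ideal_mull : forall a x, L x -> L (a * x);
  qh_ideal_mulr : forall a x, L x -> L (x * a);
  qh_ideal_coprod : forall x, L x ->
    set_add (tensor_sub L [set: A]) (tensor_sub [set: A] L) (coprod H x);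
  qh_ideal_counit : forall x, L x -> counit H x = 0;
  qh_ideal_antipode : forall x, L x -> L (antipode H x)
}.

Record grading (Gamma : groupType) (k : fieldType) (A : algType k)
    (H : quasiHopf A) := Grading {
  graded_piece :> Gamma -> set A;
  grading_subspace : forall g, is_subspace (graded_piece g);
  grading_span : forall x : A, exists p : seq Gamma * (Gamma -> A),
    [/\ uniq p.1, forall g, graded_piece g (p.2 g) & x = \sum_(g <- p.1) p.2 g];
  grading_indep : forall (s : seq Gamma) (c : Gamma -> A), uniq s ->
    (forall g, graded_piece g (c g)) -> \sum_(g <- s) c g = 0 ->
    forall g, g \in s -> c g = 0;
  gradingM : forall g h x y, graded_piece g x -> graded_piece h y ->
    graded_piece (g * h)%g (x * y);
  grading_coprod : forall g x, graded_piece g x ->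
    tensor_sub (graded_piece g) (graded_piece g) (coprod H x);
  grading_antipode : forall g x, graded_piece g x ->
    graded_piece g^-1%g (antipode H x);
  grading_coassoc :
    tensor_sub (tensor_sub (graded_piece 1%g) (graded_piece 1%g))
      (graded_piece 1%g) (coassoc H);
  grading_alpha : graded_piece 1%g (qalpha H);
  grading_beta : graded_piece 1%g (qbeta H)
}.

Definition faithful_grading (Gamma : groupType) (k : fieldType) (A : algType k)
    (H : quasiHopf A) (G : grading Gamma H) : Prop :=
  forall g, exists2 x, G g x & x != 0.

Section PaddedSums.
Variables (Gamma : eqType) (V : zmodType).

Definition pad (q : seq Gamma) (f : Gamma -> V) g := if g \in q then f g else 0.

Lemma sum_pad (M : zmodType) (q r : seq Gamma) (f : Gamma -> V)
    (F : Gamma -> V -> M) :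
  uniq q -> uniq r -> {subset q <= r} -> (forall g, F g 0 = 0) ->
  \sum_(g <- q) F g (f g) = \sum_(g <- r) F g (pad q f g).
Proof.
move=> uq ur qr F0; rewrite [RHS](bigID (mem q)) /= [X in _ + X]big1 ?addr0.
  rewrite -[RHS]big_filter.
  have -> : \sum_(g <- q) F g (f g) = \sum_(g <- q) F g (pad q f g).
    by apply: eq_big_seq => g gq; rewrite /pad gq.
  apply: perm_big; apply: uniq_perm; rewrite ?filter_uniq //.
  by move=> g; rewrite mem_filter /=; case: (boolP (g \in q)) => //= /qr ->.
by move=> g /negbTE gq; rewrite /pad gq F0.
Qed.

End PaddedSums.

Section GradingMap.
Variables (Gamma : groupType) (k : fieldType) (A : algType k).
Variables (H : quasiHopf A) (G : grading Gamma H).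

(* The map sending x = \sum_g x_g to \sum_g eps(x_g) zeta_g, computed on a chosen
   homogeneous decomposition of x; see grading_map_linear and grading_mapE. *)
Definition grading_map (x : A) : group_algebra k Gamma :=
  let p := projT1 (cid (grading_span G x)) in
  \sum_(g <- p.1) (counit H (p.2 g) : k) *: zeta g.

Let grading0 g : G g 0. Proof. by case: (grading_subspace G g). Qed.

Let grading_pad s (c : Gamma -> A) :
  (forall g, G g (c g)) -> forall g, G g (pad s c g).
Proof. by move=> cG g; rewrite /pad; case: ifP. Qed.

Lemma grading_map_sum (s : seq Gamma) (c : Gamma -> A) : uniq s ->
  (forall g, G g (c g)) ->
  grading_map (\sum_(g <- s) c g) = \sum_(g <- s) (counit H (c g) : k) *: zeta g.
Proof.
move=> us cG; rewrite /grading_map.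
case: cid => -[t d] /= [ut dG E].
pose r := undup (s ++ t); have ur : uniq r by apply: undup_uniq.
have sr : {subset s <= r} by move=> g gs; rewrite mem_undup mem_cat gs.
have tr : {subset t <= r} by move=> g gs; rewrite mem_undup mem_cat gs orbT.
pose F g a : group_algebra k Gamma := (counit H a : k) *: zeta g.
have F0 g : F g 0 = 0 by rewrite /F raddf0 scale0r.
rewrite (sum_pad (F := F) c us ur) // (sum_pad (F := F) d ut ur) //.
apply: eq_big_seq => g gr; congr F; apply/eqP; rewrite -subr_eq0; apply/eqP.
apply: (@grading_indep _ _ _ _ G r (fun g => pad t d g - pad s c g)) => //.
- move=> i; rewrite /= addrC -scaleN1r; apply: (grading_subspace G i).2;
  exact: grading_pad.
- rewrite sumrB -(sum_pad (F := fun _ => id) d ut ur) //.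
  by rewrite -(sum_pad (F := fun _ => id) c us ur) // E subrr.
Qed.

Lemma grading_map_linear : linear grading_map.
Proof.
move=> a x y.
have [[s c] [us cG ->]] := grading_span G x.
have [[t d] [ut dG ->]] := grading_span G y; rewrite /= in us cG ut dG *.
pose r := undup (s ++ t); have ur : uniq r by apply: undup_uniq.
have sr : {subset s <= r} by move=> g gs; rewrite mem_undup mem_cat gs.
have tr : {subset t <= r} by move=> g gs; rewrite mem_undup mem_cat gs orbT.
rewrite (sum_pad (F := fun _ => id) c us ur) //.
rewrite (sum_pad (F := fun _ => id) d ut ur) // scaler_sumr -big_split /=.
have cG' := grading_pad s cG; have dG' := grading_pad t dG.
rewrite !grading_map_sum // => [|g]; last exact: (grading_subspace G g).2.
rewrite scaler_sumr -big_split; apply: eq_bigr => g _ /=.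
by rewrite linearP /= scalerDl scalerA.
Qed.

Lemma grading_mapE g x : G g x -> grading_map x = (counit H x : k) *: zeta g.
Proof.
move=> Gx; pose c h := if h == g then x else 0.
have := @grading_map_sum [:: g] c isT; rewrite !big_seq1 /c eqxx; apply=> h.
by case: eqP => [->|_].
Qed.

End GradingMap.

Definition augmented (Gamma : groupType) (k : fieldType) (A : algType k)
    (H : quasiHopf A) (G : grading Gamma H) (L : set A) : Prop :=
  [set grading_map G x | x in L] = augmentation_ideal k Gamma.

(* Main.v *)
(* Let eps be the counit.

   If Y is a right A_e-stable subset of A, X is a right A_e-stable subspace and
   Y alpha lies in X, then Y lies in X, because 1 = Phi^1 beta S(Phi^2) alpha Phi^3.
   This gives that L meets every A_g trivially: for x in both and y in A_g with
   eps y = 1, each x S(y') is in L and A_e, so x alpha = x S(y') alpha y'' = 0.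

   Write h ~ f when eps is nonzero on the intersection of A_h and A_f + L. Then
   A_h is contained in A_f + L: for x in this intersection and z in A_h, apply
   u (x) v |-> z S(R u) alpha v to Delta x, where the linear map R is the identity
   on A_h and zero on L; the result is eps(x) z alpha, and it lies in A_f + L.

   By augmentation some l in L has sum_i eps(l_i) zeta_i = zeta_h - zeta_e. If h
   and e were unrelated, the components of l in the degrees unrelated to h could
   be killed one at a time by contractions of Delta, leaving an element of L on
   which eps takes the value 1, whereas eps(L) = 0. *)
From HB Require Import structures.
Require Import Defs.
From mathcomp Require Import all_boot all_algebra.
From mathcomp Require Import boolp classical_sets.

Set Implicit Arguments.
Unset Strict Implicit.
Unset Printing Implicit Defensive.

Import GRing.Theory.

Local Open Scope classical_set_scope.
Local Open Scope ring_scope.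

(** * Subspaces and their sums *)

Section Subspaces.
Variables (k : fieldType) (V : lmodType k).
Implicit Types X Y : set V.

Lemma subspace0 X : is_subspace X -> X 0.
Proof. by case. Qed.

Lemma subspaceD X x y : is_subspace X -> X x -> X y -> X (x + y).
Proof. by move=> [_ XP] Xx Xy; rewrite -[x]scale1r; apply: XP. Qed.

Lemma subspaceZ X (c : k) x : is_subspace X -> X x -> X (c *: x).
Proof. by move=> [X0 XP] Xx; rewrite -[_ *: _]addr0; apply: XP. Qed.

Lemma subspaceN X x : is_subspace X -> X x -> X (- x).
Proof. by move=> Xs Xx; rewrite -scaleN1r; apply: subspaceZ. Qed.

Lemma subspaceB X x y : is_subspace X -> X x -> X y -> X (x - y).
Proof. by move=> Xs Xx Xy; apply: subspaceD => //; apply: subspaceN. Qed.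

Lemma subspace_sum X (I : eqType) (s : seq I) (F : I -> V) :
  is_subspace X -> (forall i, i \in s -> X (F i)) -> X (\sum_(i <- s) F i).
Proof.
move=> Xs XF; rewrite big_seq; elim/big_ind: _ => //; first exact: subspace0.
by move=> x y; apply: subspaceD.
Qed.

Lemma zero_subspace : is_subspace [set 0 : V].
Proof. by split=> // c u v -> ->; rewrite scaler0 addr0. Qed.

Lemma set_add_subspace X Y :
  is_subspace X -> is_subspace Y -> is_subspace (set_add X Y).
Proof.
move=> Xs Ys; split=> [|c _ _ [x Xx [y Yy <-]] [x' Xx' [y' Yy' <-]]].
  by exists 0; [apply: subspace0|exists 0; [apply: subspace0|rewrite addr0]].
exists (c *: x + x'); first exact: Xs.2.
by exists (c *: y + y'); [exact: Ys.2|rewrite scalerDr addrACA].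
Qed.

Lemma set_addl X Y x : is_subspace Y -> X x -> set_add X Y x.
Proof.
by move=> Ys Xx; exists x => //; exists 0; rewrite ?addr0 //; apply: subspace0.
Qed.

Lemma set_addr X Y y : is_subspace X -> Y y -> set_add X Y y.
Proof.
by move=> Xs Yy; exists 0; [apply: subspace0|exists y => //; rewrite add0r].
Qed.

End Subspaces.

(** * Linear maps on spans, and extension by zero *)

Section LinearMaps.
Variables (k : fieldType) (V W : lmodType k).

Lemma lspan_min (f : V -> W) (X : set V) (Y : set W) v : linear f ->
  is_subspace Y -> (forall x, X x -> Y (f x)) -> lspan X v -> Y (f v).
Proof.
move=> fL Ys XY [s sX ->]; rewrite (sum_of_linear fL).
apply: subspace_sum => // p /sX Xp.
by rewrite (scalable_linear fL); apply: subspaceZ => //; apply: XY.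
Qed.

(* By Zorn, X and Y + H span V for a maximal H such that f is zero on the
   intersection of X and Y + H; then g is f on X and zero on Y + H. *)
Lemma linear_extension_by_zero (f : {linear V -> W})
    (X Y : set V) :
  is_subspace X -> is_subspace Y -> (forall x, X x -> Y x -> f x = 0) ->
  exists g : {linear V -> W}, [/\ forall x, X x -> g x = f x,
    forall y, Y y -> g y = 0 & forall v, exists2 x, X x & g v = f x].
Proof.
move=> Xs Ys XYf.
(* [P] does not ask for [0] in [H], so that the union of the empty chain satisfies it; maximality
   supplies [H0] afterwards. *)
pose P (H : set V) :=
  (forall (c : k) u v, H u -> H v -> H (c *: u + v)) /\
  (forall x y, X x -> Y y -> H (x - y) -> f x = 0).
have [F FP Ftot|H [[HL Hf] Hmax]] := @Zorn_bigcup V P.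
  split=> [c u v [B FB Bu] [C FC Cv]|x y Xx Yy [B FB Bxy]]; last first.
    exact: ((FP B FB).2 x y).
  have [BC|CB] := Ftot B C FB FC.
  - by exists C => //; apply: (FP C FC).1 => //; apply: BC.
  - by exists B => //; apply: (FP B FB).1 => //; apply: CB.
have H0 : H 0.
  apply: contrapT => nH0.
  have He u : ~ H u.
    by move=> Hu; apply: nH0; have := HL (-1) u u Hu Hu; rewrite scaleN1r addNr.
  apply: (Hmax [set 0]); first by split=> [u /He //|/(_ 0 erefl) /nH0].
  split; first by case: (zero_subspace V).
  by move=> x y Xx Yy /subr0_eq E; apply: XYf => //; rewrite E.
have Hs : is_subspace H by split.
pose rel v x := X x /\ exists2 y, Y y & H (v - x - y).
have relE v : exists x, rel v x.
  apply: contrapT => nrel.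
  (* Otherwise the line through [v] could be added to [H]: if [x - y] lies in [H] up to [c *: v]
     with [c != 0], then [c^-1 *: x] is related to [v]. *)
  pose B := [set b | exists c : k, H (b - c *: v)].
  have Bv : B v by exists 1; rewrite scale1r subrr.
  apply: (Hmax B).
    split=> [u Hu|BH]; first by exists 0; rewrite scale0r subr0.
    apply: nrel; exists 0; split; first exact: subspace0.
    by exists 0; [apply: subspace0|rewrite !subr0; apply: BH].
  split=> [c u w [a Ha] [b Hb]|x y Xx Yy [c]].
    exists (c * a + b).
    have -> : c *: u + w - (c * a + b) *: v = c *: (u - a *: v) + (w - b *: v).
      by rewrite scalerBr scalerDl scalerA opprD addrACA.
    exact: HL.
  have [->|c0] := eqVneq c 0; first by rewrite scale0r subr0; apply: Hf.
  move=> Hc; case: nrel; exists (c^-1 *: x).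
  split; first exact: subspaceZ.
  exists (- c^-1 *: y); first exact: subspaceZ.
  have -> : v - c^-1 *: x - - c^-1 *: y = - c^-1 *: (x - y - c *: v).
    rewrite !scalerBr !scaleNr !opprK scalerA mulVf // scale1r.
    by rewrite -addrA addrC.
  exact: subspaceZ.
have relf v x x' : rel v x -> rel v x' -> f x = f x'.
  move=> [Xx [y Yy Hy]] [Xx' [y' Yy' Hy']]; apply/subr0_eq.
  rewrite -raddfB; apply: (Hf _ (y' - y)); try exact: subspaceB.
  have -> : x - x' - (y' - y) = (v - x' - y') - (v - x - y).
    by rewrite !opprB [RHS](AC (3*(1*2)) ((1*6)*((5*2)*(4*3)))) /= subrr add0r.
  exact: subspaceB.
have relL c u x v y : rel u x -> rel v y -> rel (c *: u + v) (c *: x + y).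
  move=> [Xx [a Ya Ha]] [Xy [b Yb Hb]]; split; first exact: Xs.2.
  exists (c *: a + b); first exact: Ys.2.
  have -> : c *: u + v - (c *: x + y) - (c *: a + b)
            = c *: (u - x - a) + (v - y - b).
    by rewrite !scalerBr !opprD [X in X + _ = _]addrACA [LHS]addrACA.
  exact: HL.
have [r rP] := choice relE.
(* The choice [r] need not be linear; [f \o r] is, because by [relf] the value of [f] does not
   depend on the choice. *)
have gL : linear (f \o r).
  move=> c u v /=; rewrite -linearP; apply: relf (rP _) _; exact: relL.
pose g : {linear V -> W} :=
    HB.pack (f \o r) (GRing.isLinear.Build k V W _ _ gL).
exists g; split=> [x Xx|y Yy|v] /=.
- apply: relf (rP _) _; split=> //; exists 0; first exact: subspace0.
  by rewrite !subrr.
- rewrite -(raddf0 f); apply: relf (rP _) _; split; first exact: subspace0.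
  by exists y; rewrite ?subr0 ?subrr.
- by exists (r v); [case: (rP v)|].
Qed.

End LinearMaps.

(** * Bilinear maps evaluated on tensors *)

Section TensorLift.
Variables (k : fieldType) (U V W : lmodType k) (f : U -> V -> W).
Hypothesis fB : bilinear_map f.

Lemma tlift_sum (I : Type) (s : seq I) (F : I -> U) (F' : I -> V) :
  tlift f (\sum_(i <- s) F i ⊗ F' i) = \sum_(i <- s) f (F i) (F' i).
Proof.
rewrite (sum_of_linear (tlift_linear fB)).
by apply: eq_bigr => i _; rewrite tlift_pure.
Qed.

Lemma tlift_comp (Z : lmodType k) (g : W -> Z) t : linear g ->
  g (tlift f t) = tlift (fun u v => g (f u v)) t.
Proof.
move=> gL; have [s ->] := tensor_span t.
have gfB : bilinear_map (fun u v => g (f u v)).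
  by split=> [v|u] c x y; rewrite ?fB.1 ?fB.2 gL.
rewrite tlift_sum (sum_of_linear gL) (sum_of_linear (tlift_linear gfB)).
by apply: eq_bigr => i _; rewrite tlift_pure.
Qed.

Lemma tlift_in (P : set U) (Q : set V) (X : set W) t : is_subspace X ->
  (forall u v, P u -> Q v -> X (f u v)) -> tensor_sub P Q t -> X (tlift f t).
Proof.
move=> Xs fX; apply: (lspan_min (tlift_linear fB) Xs).
by move=> _ [u Pu [v Qv <-]]; rewrite tlift_pure //; apply: fX.
Qed.

End TensorLift.

Lemma tlift_eq_in (k : fieldType) (U V W : lmodType k) (f g : U -> V -> W)
    (P : set U) (Q : set V) t : bilinear_map f -> bilinear_map g ->
  (forall u v, P u -> Q v -> f u v = g u v) -> tensor_sub P Q t ->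
  tlift f t = tlift g t.
Proof.
move=> fB gB fg tPQ; apply/subr0_eq.
have lin : linear (fun t => tlift f t - tlift g t).
  by move=> c x y; rewrite !tlift_linear // scalerBr opprD addrACA.
apply: (lspan_min lin (zero_subspace W) _ tPQ) => _ [u Pu [v Qv <-]] /=.
by rewrite !tlift_pure // fg // subrr.
Qed.

(** * Products of homogeneous elements and cancellation of [alpha] *)

Section GradedQuasiHopf.
Variables (Gamma : groupType) (k : fieldType) (A : algType k).
Variables (H : quasiHopf A) (G : grading Gamma H).

Local Notation eps := (counit H).
Local Notation S := (antipode H).
Local Notation alpha := (qalpha H).
Local Notation beta := (qbeta H).

Lemma grading_mulr1 g x y : G g x -> G 1%g y -> G g (x * y).
Proof. by move=> Gx Gy; rewrite -[g]mulg1; apply: gradingM. Qed.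

Lemma grading_mul1r g x y : G 1%g x -> G g y -> G g (x * y).
Proof. by move=> Gx Gy; rewrite -[g]mul1g; apply: gradingM. Qed.

Lemma grading_mulS g x y : G g x -> G g y -> G 1%g (x * S y).
Proof.
by move=> Gx Gy; rewrite -(mulgV g); apply/gradingM/grading_antipode.
Qed.

Lemma mulr_linearr (z : A) : linear (fun x => z * x).
Proof. by move=> c x y; rewrite mulrDr scalerAr. Qed.

Lemma antipode_alpha_bilinear : bilinear_map (fun a b => S a * alpha * b).
Proof.
split=> [b|a] c x y; first by rewrite linearP !mulrDl -!scalerAl.
by rewrite mulrDr scalerAr.
Qed.

Lemma antipode_beta_bilinear : bilinear_map (fun a b => a * beta * S b).
Proof.
split=> [b|a] c x y; first by rewrite !mulrDl -!scalerAl.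
by rewrite linearP mulrDr scalerAr.
Qed.

(* z = z Phi^1 beta S(Phi^2) alpha Phi^3, where z Phi^1 beta S(Phi^2) is in Y. *)
Lemma cancel_alpha (X Y : set A) : is_subspace X ->
  (forall x a, X x -> G 1%g a -> X (x * a)) ->
  (forall y a, Y y -> G 1%g a -> Y (y * a)) ->
  (forall y, Y y -> X (y * alpha)) -> Y `<=` X.
Proof.
move=> Xs X1 Y1 Yalpha z Yz.
pose F (t : A ⊗ A) (c : A) := tlift (fun a b => a * beta * S b) t * alpha * c.
have FB : bilinear_map F.
  split=> [c|t] d x y; rewrite /F; last by rewrite mulrDr scalerAr.
  by rewrite (tlift_linear antipode_beta_bilinear) !mulrDl -!scalerAl.
rewrite -[z]mulr1 -(coassoc_antipode H) -/F (tlift_comp FB); last first.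
  exact: mulr_linearr.
have zFB : bilinear_map (fun t c => z * F t c).
  by split=> [c|t] d x y; rewrite ?FB.1 ?FB.2 mulr_linearr.
apply: (tlift_in zFB Xs _ (grading_coassoc G)) => t c Gt Gc.
rewrite /F mulrA; apply: X1 => //.
have lin : linear (fun t => z * (tlift (fun a b => a * beta * S b) t * alpha)).
  move=> d x y; rewrite (tlift_linear antipode_beta_bilinear).
  by rewrite mulrDl -scalerAl mulr_linearr.
apply: (lspan_min lin Xs _ Gt) => _ [a Ga [b Gb <-]] /=.
rewrite (tlift_pure antipode_beta_bilinear) mulrA; apply/Yalpha/Y1 => //.
by apply: grading_mulS Gb; apply/grading_mulr1/grading_beta.
Qed.

(** * Contractions of the coproduct along functionals *)

Lemma bilinear_scale (phi : {linear A -> k^o}) :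
  bilinear_map (fun a b : A => (phi a : k) *: b).
Proof.
split=> [b|a] c x y; first by rewrite linearP /= scalerDl scalerA.
by rewrite scalerDr !scalerA mulrC.
Qed.

Lemma bilinear_scaler (phi : {linear A -> k^o}) :
  bilinear_map (fun a b : A => (phi b : k) *: a).
Proof.
split=> [b|a] c x y; last by rewrite linearP /= scalerDl scalerA.
by rewrite scalerDr !scalerA mulrC.
Qed.

(** The action of functionals on [A] through the first leg of the coproduct. It respects degrees, so
    the homogeneous components of an element can be altered separately. *)
Definition contract (phi : {linear A -> k^o}) (x : A) : A :=
  tlift (fun a b => (phi a : k) *: b) (coprod H x).

Lemma contract_linear phi : linear (contract phi).
Proof.
by move=> c x y; rewrite /contract linearP (tlift_linear (bilinear_scale phi)).
Qed.

(** By the right counit axiom, both sides are the sum of [phi x' * eps x'']. *)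
Lemma counit_contract phi x : eps (contract phi x) = phi x.
Proof.
rewrite -[x in RHS](coprod_counitr H) /contract.
rewrite (tlift_comp (bilinear_scale phi)) => [|c u v]; last exact: linearP.
rewrite (tlift_comp (bilinear_scaler eps)) => [|c u v]; last exact: linearP.
congr tlift; apply/funext => a; apply/funext => b.
by rewrite !linearZ /= /GRing.scale /= mulrC.
Qed.

Lemma contract_piece phi g x : G g x -> G g (contract phi x).
Proof.
move=> /(grading_coprod); apply: tlift_in => [|//|a b _ Gb].
- exact: bilinear_scale.
- exact: grading_subspace.
- by apply: subspaceZ => //; apply: grading_subspace.
Qed.

(** The first leg of the coproduct of [x] stays in [G g]. *)
Lemma contract_eq_in (phi psi : {linear A -> k^o}) g x :
  (forall y, G g y -> phi y = psi y) -> G g x ->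
  contract phi x = contract psi x.
Proof.
move=> phi_psi /(grading_coprod).
by apply: tlift_eq_in (bilinear_scale _) (bilinear_scale _) _ => a b /phi_psi->.
Qed.

Lemma contract_counit x : contract eps x = x.
Proof. exact: coprod_counitl. Qed.

Lemma contract0 x : contract \0 x = 0.
Proof.
rewrite /contract; have [s ->] := tensor_span (coprod H x).
rewrite (tlift_sum (bilinear_scale _)) big1 // => p _; exact: scale0r.
Qed.

(** If [eps] vanished on [G g], contracting along [eps] would agree there with contracting along
    zero; the former is the identity, so [G g] would be zero. *)
Lemma grading_counit1 g : faithful_grading G -> exists2 x, G g x & eps x = 1.
Proof.
move=> /(_ g) [x Gx /eqP x0].
have [[y [Gy /eqP y0]]|ny] := pselect (exists y, G g y /\ eps y <> 0).
  exists ((eps y : k)^-1 *: y).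
    by apply: subspaceZ => //; apply: grading_subspace.
  by rewrite linearZ /= /GRing.scale /= mulVf.
case: x0; rewrite -[x]contract_counit -[RHS](contract0 x).
apply: contract_eq_in Gx => y Gy; apply: contrapT => y0.
by apply: ny; exists y.
Qed.

(** * Homogeneous pieces modulo the ideal *)

Section Ideal.
Variables (L : set A) (LI : quasiHopf_ideal H L).
Hypothesis GF : faithful_grading G.
Hypothesis LG1 : L `&` G 1%g = [set 0].

Let Ls : is_subspace L := qh_ideal_subspace LI.
Let Gs g : is_subspace (G g) := grading_subspace G g.
Let GLs g : is_subspace (set_add (G g) L) := set_add_subspace (Gs g) Ls.

Lemma tlift_coprod_ideal (W : lmodType k) (f : A -> A -> W) (X : set W) x :
  bilinear_map f -> is_subspace X -> (forall u v, L u -> X (f u v)) ->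
  (forall u v, L v -> X (f u v)) -> L x -> X (tlift f (coprod H x)).
Proof.
move=> fB Xs Xl Xr /(qh_ideal_coprod LI) [t tL [t' tL' <-]].
rewrite -[t]scale1r tlift_linear // scale1r; apply: subspaceD => //.
  by apply: (tlift_in fB Xs _ tL) => u v Lu _; apply: Xl.
by apply: (tlift_in fB Xs _ tL') => u v _ Lv; apply: Xr.
Qed.

(** The terms with first leg in [L] are killed by [phi]; the others have second leg in [L]. *)
Lemma contract_ideal (phi : {linear A -> k^o}) x :
  (forall y, L y -> phi y = 0) -> L x -> L (contract phi x).
Proof.
move=> phiL; apply: tlift_coprod_ideal => // [|u v /phiL ->|u v Lv].
- exact: bilinear_scale.
- by rewrite scale0r; apply: subspace0.
- exact: subspaceZ.
Qed.

Lemma ideal_piece0 g x : L x -> G g x -> x = 0.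
Proof.
move=> Lx Gx; have [y Gy y1] := grading_counit1 g GF.
(* This reduces the claim to [z * alpha = 0] for [z] in the intersection. *)
apply: (@cancel_alpha [set 0] (L `&` G g)) => //.
- exact: zero_subspace.
- by move=> _ a -> _; rewrite mul0r.
- move=> z a [Lz Gz] Ga.
  by split; [apply: (qh_ideal_mulr LI)|apply: grading_mulr1].
move=> z [Lz Gz].
have -> : z * alpha = z * tlift (fun a b => S a * alpha * b) (coprod H y).
  by rewrite antipode_alpha y1 scale1r.
have lin : linear (fun t => z * tlift (fun a b => S a * alpha * b) t).
  by move=> c t u; rewrite (tlift_linear antipode_alpha_bilinear) mulr_linearr.
apply: (lspan_min lin (zero_subspace A) _ (grading_coprod Gy)).
move=> _ [a Ga [b Gb <-]] /=; rewrite (tlift_pure antipode_alpha_bilinear) !mulrA.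
suff: (L `&` G 1%g) (z * S a) by rewrite LG1 => ->; rewrite !mul0r.
by split; [apply: (qh_ideal_mulr LI)|apply: grading_mulS Gz Ga].
Qed.

Lemma piece_sub_ideal h f x : G h x -> set_add (G f) L x -> eps x <> 0 ->
  G h `<=` set_add (G f) L.
Proof.
move=> Gx [a Ga [l Ll alx]] /eqP x0.
have [R [RG RL Rim]] := @linear_extension_by_zero _ _ _ idfun (G h) L (Gs h) Ls
  (fun y Gy Ly => ideal_piece0 Ly Gy).
have X1 y c : set_add (G f) L y -> G 1%g c -> set_add (G f) L (y * c).
  move=> [b Gb [m Lm <-]] Gc; rewrite mulrDl; exists (b * c).
    exact: grading_mulr1.
  by exists (m * c) => //; apply: (qh_ideal_mulr LI).
apply: (@cancel_alpha _ (G h)) => // [y c|z Gz]; first exact: grading_mulr1.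
pose T u v := z * S (R u) * alpha * v.
have TB : bilinear_map T.
  split=> [v|u] c y w; rewrite /T; last by rewrite mulrDr scalerAr.
  by rewrite !linearP mulrDr -scalerAr !mulrDl -!scalerAl.
(* Both legs of the coproduct of [x] lie in [G h], where [R] is the identity, so the antipode axiom
   for [alpha] applies. *)
have TE : tlift T (coprod H x) = (eps x : k) *: (z * alpha).
  rewrite scalerAr -antipode_alpha (tlift_comp antipode_alpha_bilinear); last first.
    exact: mulr_linearr.
  apply: tlift_eq_in (grading_coprod Gx) => //.
    split=> [v|u] c y w; rewrite -mulr_linearr.
      by rewrite antipode_alpha_bilinear.1.
    by rewrite antipode_alpha_bilinear.2.
  by move=> u v Gu Gv; rewrite /T RG //= !mulrA.
have -> : z * alpha = (eps x : k)^-1 *: tlift T (coprod H x).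
  by rewrite TE scalerA mulVf // scale1r.
apply: subspaceZ => //; rewrite -alx raddfD /=.
(* Evaluate instead on [x = a + l]. For [a], the factor [z * S (R u)] has degree [e] because [R] has
   values in [G h], so the result stays in [G f]. For [l], a first leg in [L] is killed by [R], and
   a second leg in [L] keeps the product in [L]. *)
rewrite -[coprod H a]scale1r tlift_linear // scale1r; apply: subspaceD => //.
  apply: (tlift_in TB (GLs f) _ (grading_coprod Ga)) => u v Gu Gv.
  apply: set_addl => //; apply: grading_mul1r Gv; apply: grading_mulr1.
    by have [y Gy ->] := Rim u; apply: grading_mulS Gz Gy.
  exact: grading_alpha.
apply: set_addr => //; apply: tlift_coprod_ideal => // u v Luv.
  by rewrite /T RL // raddf0 mulr0 !mul0r; apply: subspace0.
exact: (qh_ideal_mull LI).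
Qed.

(* If G f is not contained in G h + L, contract L along a functional that is the
   counit on G h and zero on G f + L: this kills the component of degree f and
   keeps those of the degrees i with G i contained in G h + L. *)
Lemma sum_counit_related h (s : seq Gamma) (c : Gamma -> A) a :
  (forall i, G i (c i)) -> G h a -> L (a + \sum_(i <- s) c i) ->
  eps a + \sum_(i <- s | `[< G i `<=` set_add (G h) L >]) eps (c i) = 0.
Proof.
elim: s c a => [|f s IHs] c a Gc Ga.
  by rewrite !big_nil !addr0; apply: qh_ideal_counit.
rewrite !big_cons; case: asboolP => [GfGh|nGfGh] Lac.
  (* A related component is moved into [a], up to an element of [L], on which [eps] vanishes. *)
  have [b Gb [l Ll bl]] := GfGh _ (Gc f).
  rewrite addrA -bl [eps (b + l)]raddfD /= (qh_ideal_counit LI Ll) addr0 -raddfD.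
  apply: IHs => //; first exact: subspaceD.
  rewrite -[X in L X](addrK l); apply: subspaceB => //.
  by move: Lac; rewrite -bl [b + l + _]addrAC addrA addrA.
(* If [eps x] were nonzero, the [G f]-part [b] of [x] would lie in [G h + L] with the same counit,
   which would make [f] related to [h]. *)
have eps0 x : G h x -> set_add (G f) L x -> eps x = 0.
  move=> Gx [b Gb [l Ll blx]]; apply: contrapT => x0; apply: nGfGh.
  apply: (piece_sub_ideal Gb); last first.
    by rewrite -blx raddfD /= (qh_ideal_counit LI Ll) addr0 in x0.
  by exists x => //; exists (- l); [apply: subspaceN|rewrite -blx addrK].
have [phi [phih phi0 _]] := linear_extension_by_zero (Gs h) (GLs f) eps0.
have phiL y : L y -> phi y = 0 by move=> Ly; apply/phi0/set_addr.
have /(contract_ideal phiL) := Lac.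
have CD : {morph contract phi : u v / u + v}.
  by move=> u v; have := contract_linear phi 1 u v; rewrite !scale1r.
rewrite !CD (contract_eq_in phih Ga) contract_counit.
have -> : contract phi (c f) = 0.
  rewrite -[RHS](contract0 (c f)); apply: contract_eq_in (Gc f) => y Gy.
  by apply/phi0/set_addl.
rewrite add0r (sum_of_linear (contract_linear phi)).
move=> /(IHs (fun i => contract phi (c i))) IH; rewrite -[RHS]IH //; last first.
  by move=> i; apply: contract_piece.
congr (_ + _); apply: eq_bigr => i /asboolP GiGh; rewrite counit_contract.
have [b Gb [l Ll <-]] := GiGh _ (Gc i).
by rewrite !raddfD /= phih // phiL // (qh_ideal_counit LI Ll).
Qed.

Lemma piece_sub_piece1_ideal h : augmented G L -> G h `<=` set_add (G 1%g) L.
Proof.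
move=> aug.
have [l Ll lE] : [set grading_map G x | x in L] (zeta h - zeta 1%g).
  by rewrite aug; apply: lspan_incl; exists h.
have [[s c] [us Gc lsc]] := grading_span G l; rewrite /= in us Gc lsc.
pose E i := `[< G i `<=` set_add (G h) L >].
(* [chi] sums the coefficients over the degrees related to [h]. It vanishes on the image of [l] by
   [sum_counit_related], whereas on [zeta h - zeta 1] it would be [1] if [E 1] failed. *)
pose chi : group_algebra k Gamma -> k^o := malg_lift (fun i => (E i)%:R : k^o).
have chiL : linear chi by exact: linearP.
have chiz i : chi (zeta i) = (E i)%:R by rewrite zeta.unlock /chi malg_liftU.
have sum0 : \sum_(i <- s | E i) eps (c i) = 0.
  have := @sum_counit_related h s c 0 Gc (subspace0 (Gs h)).
  by rewrite raddf0 !add0r -lsc; apply.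
have : chi (grading_map G l) = 0.
  rewrite lsc grading_map_sum // (sum_of_linear chiL) -[RHS]sum0 [RHS]big_mkcond /=.
  apply: eq_bigr => i _; rewrite (scalable_linear chiL) chiz.
  by case: (E i); rewrite /= ?scaler0 // /GRing.scale /= mulr1.
rewrite lE addrC -scaleN1r chiL !chiz.
have -> : E h by apply/asboolP => x Gx; apply: set_addl.
have [/asboolP G1|_] := boolP (E 1%g); last first.
  by rewrite scaler0 add0r => /eqP; rewrite oner_eq0.
(* The inclusion obtained is the reverse one; the [G h]-part [b] of [y] has counit [1] and lies in
   [G 1 + L], so [piece_sub_ideal] turns it around. *)
move=> _; have [y Gy y1] := grading_counit1 1%g GF.
have [b Gb [m Lm bmy]] := G1 _ Gy.
apply: (piece_sub_ideal Gb).
  by exists y => //; exists (- m); [apply: subspaceN|rewrite -bmy addrK].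
move: y1; rewrite -bmy raddfD /= (qh_ideal_counit LI Lm) addr0 => ->.
exact/eqP/oner_neq0.
Qed.

End Ideal.
End GradedQuasiHopf.

Theorem theorem5p16 (Gamma : groupType) (k : fieldType) (A : algType k)
    (H : quasiHopf A) (G : grading Gamma H) (L : set A) :
  faithful_grading G ->
  quasiHopf_ideal H L ->
  augmented G L ->
  L `&` G 1%g = [set 0] ->
  [set: A] = set_add (G 1%g) L.
Proof.
move=> GF LI aug LG1; apply/esym/seteqP; split=> // x _.
have [[s c] [_ Gc ->]] := grading_span G x; rewrite /= in Gc *.
apply: subspace_sum => [|i _]; last exact: piece_sub_piece1_ideal (Gc i).
exact: set_add_subspace (grading_subspace G _) (qh_ideal_subspace LI).
Qed.
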